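(* Let $H$ be a complex Hilbert space and let $B(H)$ be the algebra of all bounded linear operators on $H$. Suppose that $\phi:B(H)\to B(H)$ is a linear bijection preserving the left ideals of $B(H)$ in both directions, i.e., for every subset $\mathcal L\subseteq B(H)$, $\mathcal L$ is a left ideal of $B(H)$ if and only if $\phi(\mathcal L)$ is a left ideal of $B(H)$. Then there are invertible operators $A,B\in B(H)$ such that \[ \phi(T)=ATB \quad \text{for all } T\in B(H). \]
   Context: Left ideals are understood in the purely algebraic sense (not assumed to be closed in any topology). No continuity of $\phi$ is assumed. *)

(* Defs.v *)
From HB Require Import structures.
From mathcomp Require Import all_boot all_order all_algebra sesquilinear.
From mathcomp Require Import complex.
From mathcomp Require Import boolp classical_sets functions reals topology.
From mathcomp Require Import normedtype.

Set Implicit Arguments.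
Unset Strict Implicit.
Unset Printing Implicit Defensive.

Import Order.TTheory GRing.Theory Num.Theory.
Import numFieldNormedType.Exports.

Local Open Scope classical_set_scope.
Local Open Scope ring_scope.

Section BoundedOp.
Variables (K : numFieldType) (V : normedModType K).

Definition bounded_linear : {pred V -> V} := fun T =>
  `[< linear T /\ exists2 M : K, 0 <= M & forall x, `|T x| <= M * `|x| >].

Record boundedOp := BoundedOp {
  bop_fun :> V -> V;
  bop_funP : bop_fun \in bounded_linear
}.

HB.instance Definition _ := [isSub for bop_fun].
HB.instance Definition _ := [Choice of boundedOp by <:].

Lemma bounded_linearP (T : V -> V) :
  reflect (linear T /\ exists2 M : K, 0 <= M & forall x, `|T x| <= M * `|x|)
          (T \in bounded_linear).
Proof. exact: asboolP. Qed.

Lemma bounded_linear_submod : submod_closed bounded_linear.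
Proof.
split.
  apply/bounded_linearP; split; first by move=> a x y; rewrite scaler0 addr0.
  by exists 0 => // x; rewrite normr0 mul0r.
move=> a S T /bounded_linearP[lS [M M0 bS]] /bounded_linearP[lT [N N0 bT]].
apply/bounded_linearP; split => [b x y|].
  have E z : (a *: S + T) z = a *: S z + T z by [].
  by rewrite !E lS lT !scalerDr !scalerA [b * a]mulrC addrACA.
exists (`|a| * M + N); first by rewrite addr_ge0// mulr_ge0.
move=> x; have -> : (a *: S + T) x = a *: S x + T x by [].
rewrite (le_trans (ler_normD _ _))// normrZ mulrDl lerD//.
by rewrite -mulrA ler_wpM2l.
Qed.

HB.instance Definition _ :=
  GRing.isSubmodClosed.Build K (V -> V) bounded_linear
    (GRing.submod_closed_semi bounded_linear_submod).
HB.instance Definition _ := [SubChoice_isSubLmodule of boundedOp by <:].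

Lemma boundedOp_eq (S T : boundedOp) : S =1 T -> S = T.
Proof. by move=> ST; apply/val_inj/funext. Qed.

Lemma bop_linear (T : boundedOp) : linear T.
Proof. by case: T => T /= /bounded_linearP[]. Qed.

Lemma bop_bounded (T : boundedOp) :
  exists2 M : K, 0 <= M & forall x, `|T x| <= M * `|x|.
Proof. by case: T => T /= /bounded_linearP[]. Qed.

HB.instance Definition _ (T : boundedOp) :=
  GRing.isLinear.Build K V V *:%R (bop_fun T) (@bop_linear T).

Lemma bounded_linear_id : idfun \in bounded_linear.
Proof.
by apply/bounded_linearP; split=> //; exists 1 => // x; rewrite mul1r.
Qed.

Lemma bounded_linear_comp (S T : boundedOp) : S \o T \in bounded_linear.
Proof.
apply/bounded_linearP; split; first by move=> a x y /=; rewrite !linearP.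
have [[M M0 bS] [N N0 bT]] := (bop_bounded S, bop_bounded T).
exists (M * N) => [|x /=]; first exact: mulr_ge0.
by rewrite (le_trans (bS _))// -mulrA ler_wpM2l.
Qed.

Definition bop_one := BoundedOp bounded_linear_id.
Definition bop_comp (S T : boundedOp) := BoundedOp (bounded_linear_comp S T).

Fact bop_compA : associative bop_comp.
Proof. by move=> S T U; apply: boundedOp_eq. Qed.
Fact bop_comp1l : left_id bop_one bop_comp.
Proof. by move=> S; apply: boundedOp_eq. Qed.
Fact bop_comp1r : right_id bop_one bop_comp.
Proof. by move=> S; apply: boundedOp_eq. Qed.
Fact bop_compDl : left_distributive bop_comp +%R.
Proof. by move=> S T U; apply: boundedOp_eq. Qed.
Fact bop_compDr : right_distributive bop_comp +%R.
Proof. by move=> S T U; apply: boundedOp_eq => x /=; rewrite linearD. Qed.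

(* Only a pzRingType: when V = 0, the ring of operators is trivial. *)
HB.instance Definition _ := GRing.Zmodule_isPzRing.Build boundedOp
  bop_compA bop_comp1l bop_comp1r bop_compDl bop_compDr.

Lemma bop1E x : (1 : boundedOp) x = x. Proof. by []. Qed.
Lemma bopME (S T : boundedOp) x : (S * T) x = S (T x). Proof. by []. Qed.
Lemma bop0E x : (0 : boundedOp) x = 0. Proof. by []. Qed.
Lemma bopDE (S T : boundedOp) x : (S + T) x = S x + T x. Proof. by []. Qed.
Lemma bopNE (T : boundedOp) x : (- T) x = - T x. Proof. by []. Qed.
Lemma bopZE a (T : boundedOp) x : (a *: T) x = a *: T x. Proof. by []. Qed.

End BoundedOp.

Arguments boundedOp {K} V.

(* The library's units and ideals assume a nontrivial ring (and its ideals are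
   proper), hence the next two definitions.  In boundedOp V, closure of left
   ideals under scalars is automatic, since a *: T = (a *: 1) * T. *)
Definition left_ideal (A : pzRingType) (L : set A) : Prop :=
  [/\ L 0, forall x y, L x -> L y -> L (x - y) & forall a x, L x -> L (a * x)].

Definition invertible (A : pzRingType) (x : A) : Prop :=
  exists y, x * y = 1 /\ y * x = 1.

(* Main.v *)
From HB Require Import structures.
Require Import Defs.
From mathcomp Require Import all_boot all_order all_algebra sesquilinear.
From mathcomp Require Import complex.
From mathcomp Require Import boolp classical_sets functions reals topology.
From mathcomp Require Import normedtype.
From mathcomp Require Import ring.
Import numFieldNormedType.Exports.
Local Open Scope classical_set_scope.
Local Open Scope ring_scope.
Import Order.TTheory GRing.Theory Num.Theory.
Set Implicit Arguments.
Unset Strict Implicit.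
Unset Printing Implicit Defensive.

(** Let M_x be the left ideal of the operators vanishing at x.  The M_x with x
    nonzero are exactly the maximal left ideals that meet some nonzero left
    ideal trivially, so phi permutes them: phi T y = 0 iff T x = 0 for some
    y depending on x.  Hence phi T y = Q_x (T x) for a linear bijection Q_x.
    Testing on the T such that phi T has rank one, vanishes at y_1 and not at
    y_2 shows that Q_(x_1 + x_2) is proportional to Q_(x_2) for independent x_1
    and x_2, so all the Q_x are proportional to a single S.  Rescaling y gives
    phi T (D x) = S (T x), where necessarily D x = S (phi^-1 1 x), and D is
    bijective: phi T = S T D^-1.  Taking T of rank one, every functional
    <h, D^-1 y> is bounded in y, hence D^-1 is bounded by the uniform
    boundedness principle, and likewise D.  Finally S = phi 1 D and
    S^-1 = phi^-1 1 D^-1 are bounded. *)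

(** * Maximal left ideals and their images under preservers *)

Section LeftIdeals.
Variable A : pzRingType.
Implicit Types (L N : set A).

Definition maximal_left_ideal L :=
  [/\ left_ideal L, L <> setT &
      forall L', left_ideal L' -> L `<=` L' -> L' = L \/ L' = setT].

Definition disjoint_left_ideal L N :=
  [/\ left_ideal N, exists2 a, N a & a <> 0 & forall a, L a -> N a -> a = 0].

(** Maximality alone does not single out the M_x: in infinite dimension some maximal left ideals
    contain all operators of finite rank, and these meet every nonzero left ideal nontrivially. *)
Definition split_maximal L :=
  maximal_left_ideal L /\ exists N, disjoint_left_ideal L N.

Lemma left_ideal_setT L : left_ideal L -> L 1 -> L = setT.
Proof.
by move=> [_ _ LM] L1; rewrite -subTset => a _; rewrite -[a]mulr1; apply: LM.
Qed.

Lemma left_ideal_add L N : left_ideal L -> left_ideal N ->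
  left_ideal [set a | exists l n, [/\ L l, N n & a = l + n]].
Proof.
move=> [L0 LB LM] [N0 NB NM]; split.
- by exists 0, 0; rewrite addr0.
- move=> _ _ [l [n [Ll Nn ->]]] [l' [n' [Ll' Nn' ->]]].
  by exists (l - l'), (n - n'); rewrite opprD addrACA; split; auto.
- move=> a _ [l [n [Ll Nn ->]]].
  by exists (a * l), (a * n); rewrite mulrDr; split; auto.
Qed.

(** Maximality forces L + N to be the whole ring, so 1 = l + e with l in L and e in N. For a in L, a
    e = a - a l then lies in both L and N. *)
Lemma split_maximal_idempotent L : split_maximal L ->
  exists2 e, e <> 0 & forall a, L a -> a * e = 0.
Proof.
move=> [[Lid LT Lmax] [N [Nid [a Na a0] LN0]]].
have [L0 LB LM] := Lid; have [N0 NB NM] := Nid.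
have sumid := left_ideal_add Lid Nid.
have sub : L `<=` [set a | exists l n, [/\ L l, N n & a = l + n]].
  by move=> l Ll; exists l, 0; rewrite addr0.
case: (Lmax _ sumid sub) => sumE.
  case: a0; apply: LN0 => //; rewrite -sumE.
  by exists 0, a; rewrite add0r.
have [l [e [Ll Ne le1]]] : [set a | exists l n, [/\ L l, N n & a = l + n]] 1.
  by rewrite sumE.
exists e => [e0|b Lb].
  by apply/LT/left_ideal_setT => //; rewrite le1 e0 addr0.
apply: LN0; last exact: NM.
have -> : b * e = b - b * l.
  by rewrite -{2}[b]mulr1 le1 mulrDr addrAC subrr add0r.
by apply: LB => //; apply: LM.
Qed.

Definition left_ideal_preserver (f : A -> A) :=
  forall L, left_ideal L <-> left_ideal (f @` L).

Lemma image_canK (f g : A -> A) L : cancel g f -> f @` (g @` L) = L.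
Proof.
move=> gK; rewrite image_comp eqEsubset; split=> [_ [a La <-]|a La] /=.
  by rewrite gK.
by exists a => //=; rewrite gK.
Qed.

Lemma left_ideal_preserver_can (f g : A -> A) : cancel g f ->
  left_ideal_preserver f -> left_ideal_preserver g.
Proof.
by move=> gK fP L; rewrite (fP (g @` L)) image_canK.
Qed.

Lemma split_maximal_image (f g : A -> A) L : cancel f g -> cancel g f ->
    f 0 = 0 -> left_ideal_preserver f ->
  split_maximal L -> split_maximal (f @` L).
Proof.
move=> fK gK f0 fP [[Lid LT Lmax] [N [Nid [a Na a0] LN0]]].
have gP := left_ideal_preserver_can gK fP.
split; [split|].
- exact: (fP L).1.
- move=> fLT; apply: LT; rewrite -(image_canK L fK) fLT -subTset => b _.
  by exists (f b).
- move=> L' /(gP _).1 L'id fLL'.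
  have sub : L `<=` g @` L'.
    by move=> b Lb; exists (f b); [apply: fLL'; exists b|].
  case: (Lmax _ L'id sub) => E; [left|right]; rewrite -(image_canK L' gK) E //.
  by rewrite -subTset => b _; exists (g b).
- exists (f @` N); split; first exact: (fP N).1.
    exists (f a); first by exists a.
    by rewrite -f0 => /(can_inj fK).
  by move=> _ [b Lb <-] [c Nc /(can_inj fK) cb]; rewrite (LN0 b) // -cb.
Qed.

End LeftIdeals.

(** * Convergence at a geometric rate *)

Section Complete.
Variables (R : realType) (V : completeNormedModType R[i]).

Lemma complex_nat_bound (M : R[i]) : 0 <= M -> exists n, M <= n%:R.
Proof.
move=> M0; exists (Num.truncn (complex.Re M)).+1.
have /complex_realP[r rE] := ger0_real M0.
by rewrite rE /= -(rmorph_nat (real_complex R)) lecR ltW // truncnS_gt.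
Qed.

Lemma geometric_limit (x : nat -> V) :
    (forall n, `|x n.+1 - x n| <= 3^-1 ^+ n) ->
  exists l, forall n, `|l - x n| <= 3 / 2 * 3^-1 ^+ n.
Proof.
move=> xP; set q : R[i] := 3^-1.
have q0 n : 0 < q ^+ n by rewrite exprn_gt0 // invr_gt0 ltr0n.
have c0 : 0 < 3 / 2 :> R[i] by rewrite divr_gt0 // ltr0n.
(* Telescoping: the right-hand side is the exact sum of q^k for n <= k < n + m, since 1 / (1 - q) =
   3 / 2. *)
have step n m : `|x (n + m)%N - x n| <= 3 / 2 * q ^+ n - 3 / 2 * q ^+ (n + m).
  elim: m => [|m IH]; first by rewrite addn0 !subrr normr0.
  rewrite addnS -[x _.+1](subrK (x (n + m)%N)) -addrA addrC.
  apply: le_trans (ler_normD _ _) _; apply: le_trans (lerD IH (xP _)) _.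
  rewrite -/q -addrA lerD2l exprS le_eqVlt; apply/orP; left; apply/eqP.
  by rewrite /q; field.
have step_le n m : (n <= m)%N -> `|x m - x n| <= 3 / 2 * q ^+ n.
  move=> /subnKC <-; apply: le_trans (step _ _) _.
  by rewrite lerBlDr lerDl ltW // mulr_gt0.
have small e : 0 < e -> exists n, 3 / 2 * q ^+ n < e.
  move=> e0; have [|n nP] := @complex_nat_bound (3 / 2 / e).
    by rewrite ltW // divr_gt0.
  exists n; rewrite /q exprVn ltr_pdivrMr ?exprn_gt0 ?ltr0n //.
  rewrite [e * _]mulrC -ltr_pdivrMr //.
  by apply: le_lt_trans nP _; rewrite -natrX ltr_nat ltn_expl.
have xcvg : cvg (x @ \oo).
  apply: cauchy_cvg; apply: cauchy_exP => e /small[n ne].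
  exists (x n); rewrite /= /fmap /=; exists n => // m /= nm.
  rewrite -ball_normE /ball_ /= distrC; exact: le_lt_trans (step_le _ _ nm) ne.
exists (lim (x @ \oo)) => n.
have bound_ge0 : 0 <= 3 / 2 * q ^+ n by rewrite ltW // mulr_gt0.
rewrite real_leNgt ?ger0_real //; apply/negP => lt.
have /cvgrPdist_lt/(_ (`|lim (x @ \oo) - x n| - 3 / 2 * q ^+ n)) := xcvg.
rewrite subr_gt0 => /(_ lt)[N _ /(_ (maxn n N) (leq_maxr _ _))] /=.
apply/negP; rewrite -real_leNgt ?ger0_real ?subr_ge0 ?(ltW lt) //.
rewrite lerBlDr -(subrKA (x (maxn n N))).
by apply: le_trans (ler_normD _ _) _; rewrite lerD2l step_le // leq_maxl.
Qed.

End Complete.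

Section LinearMaps.
Variables (K : pzRingType) (U V : lmodType K) (h : U -> V).
Hypothesis h_linear : linear h.

Lemma linear_map0 : h 0 = 0.
Proof. by have := h_linear (-1) 0 0; rewrite scaler0 addr0 scaleN1r addNr. Qed.

Lemma linear_mapZ a x : h (a *: x) = a *: h x.
Proof. by rewrite -[a *: x]addr0 h_linear linear_map0 addr0. Qed.

Lemma can_linear (h' : V -> U) : cancel h h' -> cancel h' h -> linear h'.
Proof. by move=> hK h'K a x y; apply: (can_inj hK); rewrite h_linear !h'K. Qed.

End LinearMaps.

(** * Inner products, separation and rank-one operators *)

Section Hilbert.
Variables (R : realType) (H : completeNormedModType R[i]).
Variables (dot : {dot H for Num.conj}).
Hypothesis norm_dot : forall x : H, `|x| ^+ 2 = dot x x.

Lemma dotC x y : dot x y = (dot y x)^*.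
Proof. by rewrite (hermC dot) expr0 mul1r. Qed.

Lemma dotZl a x y : dot (a *: x) y = a * dot x y.
Proof. exact: (linearZl_LR dot). Qed.

Lemma dotZr a x y : dot x (a *: y) = a^* * dot x y.
Proof. exact: (linearZr_LR dot). Qed.

Lemma dotDl x y z : dot (x + y) z = dot x z + dot y z.
Proof. exact: (linearDl dot). Qed.

Lemma dotBl x y z : dot (x - y) z = dot x z - dot y z.
Proof. exact: (linearBl dot). Qed.

Lemma dotBr x y z : dot x (y - z) = dot x y - dot x z.
Proof. exact: (linearBr dot). Qed.

Lemma dot_eq0 x : (dot x x == 0) = (x == 0).
Proof. by rewrite -norm_dot expf_eq0 normr_eq0. Qed.

Lemma dot_projection x y : dot (y - (dot y x / dot x x) *: x) x = 0.
Proof.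
rewrite dotBl dotZl; have [->|x0] := eqVneq x 0.
  by rewrite !(linear0r dot) mulr0 subrr.
by rewrite divfK ?dot_eq0 // subrr.
Qed.

Lemma Cauchy_Schwarz x y : `|dot x y| <= `|x| * `|y|.
Proof.
have [->|y0] := eqVneq y 0; first by rewrite (linear0r dot) !normr0 mulr0.
set a := dot x y / dot y y; have ort := dot_projection y x.
have pos : 0 < dot y y by rewrite -norm_dot exprn_gt0 // normr_gt0.
have : 0 <= dot (x - a *: y) (x - a *: y) by rewrite -norm_dot exprn_ge0.
rewrite dotBr dotZr ort mulr0 subr0 dotBl dotZl (dotC y x) mulrAC -normCK.
rewrite subr_ge0 ler_pdivrMr // -!norm_dot -exprMn.
by rewrite ler_pXn2r ?nnegrE ?mulr_ge0.
Qed.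

(** A rescaled component of y orthogonal to x serves as [h]. The case x = 0 is included and yields
    [separating1]. *)
Lemma separating x y : (forall c, y <> c *: x) ->
  exists h, dot x h = 0 /\ dot y h = 1.
Proof.
move=> nxy; set a := dot y x / dot x x; set h := y - a *: x.
have hx : dot x h = 0 by rewrite dotC dot_projection conjC0.
have h0 : dot h h != 0 by rewrite dot_eq0 subr_eq0; apply/eqP.
(* The scalar is conjugated because [dot] is conjugate-linear in its second argument. *)
exists (((dot h h)^-1)^* *: h); rewrite !dotZr hx mulr0 conjCK; split=> //.
rewrite -[y](subrK (a *: x)) -/h (dotDl h (a *: x)) dotZl hx.
by rewrite mulr0 addr0 mulVf.
Qed.

Lemma separating1 y : y <> 0 -> exists h, dot y h = 1.
Proof.
move=> y0; have [|h []] := @separating 0 y; first by move=> c; rewrite scaler0.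
by exists h.
Qed.

Lemma rank1_bounded v h : (fun z => dot z h *: v) \in @bounded_linear _ H.
Proof.
apply/bounded_linearP; split.
  by move=> a x y; rewrite dotDl dotZl scalerDl scalerA.
exists (`|h| * `|v|) => [|x]; first exact: mulr_ge0.
by rewrite normrZ mulrAC ler_wpM2r // mulrC Cauchy_Schwarz.
Qed.

Definition rank1 v h : boundedOp H := BoundedOp (rank1_bounded v h).

Lemma rank1E v h z : rank1 v h z = dot z h *: v. Proof. by []. Qed.

(** * The ideals M_x *)

Definition vanishing (x : H) : set (boundedOp H) := [set T | T x = 0].

Lemma left_ideal_vanishing x : left_ideal (vanishing x).
Proof.
split=> //= [S T Sx Tx|S T Tx]; rewrite /vanishing /=.
  by rewrite -[LHS]/(S x - T x) Sx Tx subr0.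
by rewrite Tx linear0.
Qed.

Lemma vanishing_proper x : x <> 0 -> vanishing x <> setT.
Proof. by move=> x0 E; apply: x0; have : vanishing x 1 by rewrite E. Qed.

(** If T in L does not kill x, some [rank1 x h * T] fixes x, hence differs from 1 by an element of
    M_x. *)
Lemma vanishing_maximal x : x <> 0 -> maximal_left_ideal (vanishing x).
Proof.
move=> x0; split; [exact: left_ideal_vanishing|exact: vanishing_proper|].
move=> L Lid xL; have [_ LB LM] := Lid.
have [Lx|] := pselect (L `<=` vanishing x); [by left; rewrite eqEsubset|].
move/existsNP => [T /not_implyP[LT /separating1[h Txh]]]; right.
apply: left_ideal_setT => //.
have -> : 1 = rank1 x h * T - (rank1 x h * T - 1) by rewrite opprB addrC subrK.
apply: LB; first exact: LM.
apply: xL; rewrite /vanishing /= -[LHS]/(rank1 x h (T x) - x).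
by rewrite rank1E Txh scale1r subrr.
Qed.

Lemma vanishing_split_maximal x : x <> 0 -> split_maximal (vanishing x).
Proof.
move=> x0; split; first exact: vanishing_maximal.
have [h xh] := separating1 x0.
(* The left ideal generated by the idempotent [rank1 x h]; its elements are determined by their
   value at x. *)
exists [set T : boundedOp H | T = T * rank1 x h]; split.
- split=> [|S T /= SE TE|S T /= TE]; first by rewrite /= mul0r.
    by rewrite mulrBl -SE -TE.
  by rewrite -mulrA -TE.
- exists (rank1 x h); last first.
    by move/(congr1 (fun S : boundedOp H => S x)); rewrite rank1E xh scale1r.
  by apply: boundedOp_eq => z; rewrite bopME /= dotZl xh mulr1.
- move=> T Tx ->; apply: boundedOp_eq => z.
  by rewrite bopME rank1E linearZ /= Tx scaler0.
Qed.

Lemma split_maximal_vanishing L : split_maximal L ->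
  exists2 x, x <> 0 & L = vanishing x.
Proof.
move=> Lsm; have [[_ LT Lmax] _] := Lsm.
have [e e0 eL] := split_maximal_idempotent Lsm.
have [x ex] : exists x, e x <> 0.
  apply: contrapT => /forallNP ex.
  by apply/e0/boundedOp_eq => x; apply: contrapT.
exists (e x) => //.
(* T e = 0 says that T kills the range of e; maximality of L then gives equality. *)
have sub : L `<=` vanishing (e x).
  by move=> T /eL /(congr1 (fun S : boundedOp H => S x)).
by case: (Lmax _ (left_ideal_vanishing (e x)) sub) => // /(vanishing_proper ex).
Qed.

(** * The maps Q_x and their proportionality *)

Section Preserver.
Variables f g : {linear boundedOp H -> boundedOp H}.
Hypotheses (fK : cancel f g) (gK : cancel g f).
Hypothesis fP : left_ideal_preserver f.

Lemma preserver_vanishing x : x <> 0 ->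
  exists2 y, y <> 0 & forall T, f T y = 0 <-> T x = 0.
Proof.
move=> /vanishing_split_maximal.
move=> /(split_maximal_image fK gK (linear0 f) fP).
move=> /split_maximal_vanishing[y y0 E]; exists y => // T.
have -> : (f T y = 0) = (f @` vanishing x) (f T) by rewrite E.
split=> [[S Sx /(can_inj fK) <-] //|Tx]; by exists T.
Qed.


Definition evaluates_to (x y : H) (Q : H -> H) :=
  forall T, f T y = Q (T x).

Lemma evaluates_to_linear x y Q : x <> 0 -> evaluates_to x y Q -> linear Q.
Proof.
move=> /separating1[h xh] fQ a u v.
have QE w : Q w = f (rank1 w h) y by rewrite fQ rank1E xh scale1r.
rewrite !QE -bopZE -bopDE -linearP; congr (f _ y).
apply: boundedOp_eq => z; rewrite bopDE bopZE !rank1E.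
by rewrite scalerDr !scalerA mulrC.
Qed.

End Preserver.

Section Evaluation.
Variables f g : {linear boundedOp H -> boundedOp H}.
Hypotheses (fK : cancel f g) (gK : cancel g f).
Hypothesis fP : left_ideal_preserver f.

(** When <x, h> = 1, T and [rank1 (T x) h] agree at x, so their images agree at y and [f T y]
    depends on T x only. The same argument for [g], from y back to x, gives the inverse. *)
Lemma preserver_evaluation x : x <> 0 -> exists y Q Q',
  [/\ y <> 0, cancel Q Q', cancel Q' Q & evaluates_to f x y Q].
Proof.
move=> x0; have [y y0 fxy] := preserver_vanishing fK gK fP x0.
have [[h xh] [k yk]] := (separating1 x0, separating1 y0).
have fE T : f T y = f (rank1 (T x) h) y.
  apply/eqP; rewrite -subr_eq0 -[X in X == 0]/((f T - f (rank1 (T x) h)) y).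
  rewrite -linearB; apply/eqP/fxy.
  by rewrite bopDE bopNE rank1E xh scale1r subrr.
have gE V : g V x = g (rank1 (V y) k) x.
  apply/eqP; rewrite -subr_eq0 -[X in X == 0]/((g V - g (rank1 (V y) k)) x).
  rewrite -linearB; apply/eqP/fxy; rewrite gK.
  by rewrite bopDE bopNE rank1E yk scale1r subrr.
exists y, (fun w => f (rank1 w h) y), (fun v => g (rank1 v k) x); split => //.
- by move=> w; rewrite -gE fK rank1E xh scale1r.
- by move=> v; rewrite -fE gK rank1E yk scale1r.
Qed.

Lemma evaluation_add (x1 x2 y1 y2 y : H) (Q1 Q2 Q : H -> H) :
    (forall c : R[i], x2 <> c *: x1) -> injective Q1 -> injective Q2 ->
    linear Q1 -> linear Q2 ->
    evaluates_to f x1 y1 Q1 -> evaluates_to f x2 y2 Q2 ->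
    evaluates_to f (x1 + x2) y Q ->
  exists c, forall w, Q w = c *: Q2 w.
Proof.
move=> x12 injQ1 injQ2 linQ1 linQ2 E1 E2 E.
have [Q10 Q20] := (linear_map0 linQ1, linear_map0 linQ2).
(* An operator killing x1 but not x2 shows that y2 is not a multiple of y1. *)
have y12 c : y2 <> c *: y1.
  move=> yc; have [h [x1h x2h]] := separating x12.
  suff : rank1 x2 h x2 = 0.
    by rewrite rank1E x2h scale1r => x20; apply: (x12 0); rewrite scale0r.
  apply: injQ2; rewrite Q20 -E2 yc linearZ /= E1 rank1E x1h scale0r Q10.
  by rewrite scaler0.
have [k [y1k y2k]] := separating y12.
(* T kills x1 and sends x2 to w, so [f T y] is both Q w and <y, k> Q2 w; [k] does not depend on
   w. *)
exists (dot y k) => w; pose T := g (rank1 (Q2 w) k).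
have Tx1 : T x1 = 0 by apply: injQ1; rewrite -E1 gK rank1E y1k scale0r.
have Tx2 : T x2 = w by apply: injQ2; rewrite -E2 gK rank1E y2k scale1r.
by have := E T; rewrite gK rank1E linearD /= Tx1 Tx2 add0r.
Qed.

Lemma preserver_intertwines (x0 : H) : x0 <> 0 -> exists S S' : H -> H,
  [/\ linear S, cancel S S', cancel S' S &
      forall x, exists y, evaluates_to f x y S].
Proof.
move=> x00; have [y0 [S [S' [y00 SK S'K E0]]]] := preserver_evaluation x00.
have linS := evaluates_to_linear x00 E0.
exists S, S'; split=> // x.
have [[c ->]|/forallNP x0x] := pselect (exists c, x = c *: x0).
  by exists (c *: y0) => T; rewrite !linearZ /= E0 (linear_mapZ linS).
have xn0 : x <> 0 by move=> x_0; apply: (x0x 0); rewrite scale0r.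
have xx0 c : x0 <> c *: x.
  move=> x0E; have [c0|c0] := eqVneq c 0.
    by apply: x00; rewrite x0E c0 scale0r.
  by apply: (x0x c^-1); rewrite x0E scalerA mulVf // scale1r.
have xDn0 : x0 + x <> 0.
  by move=> /eqP; rewrite addr_eq0 => /eqP; rewrite -scaleN1r => /xx0.
(* With P the map of x0 + x, adding in both orders gives P = c Q and P = d S, so S = (c / d) Q and
   the factor is absorbed into y. *)
have [y [Q [Q' [yn0 QK Q'K E]]]] := preserver_evaluation xn0.
have linQ := evaluates_to_linear xn0 E.
have [z [P [P' [zn0 PK P'K EP]]]] := preserver_evaluation xDn0.
have [c Pc] := evaluation_add x0x (can_inj SK) (can_inj QK) linS linQ E0 E EP.
rewrite addrC in EP.
have [d Pd] := evaluation_add xx0 (can_inj QK) (can_inj SK) linQ linS E E0 EP.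
have d0 : d != 0.
  apply/eqP => d0; apply: x00; apply: (can_inj PK); rewrite !Pd d0.
  by rewrite !scale0r.
exists ((d^-1 * c) *: y) => T.
by rewrite linearZ /= E -scalerA -Pc Pd scalerA mulVf // scale1r.
Qed.

End Evaluation.

(** * The spatial form and boundedness *)

Lemma preserver_spatial (f g : {linear boundedOp H -> boundedOp H}) (x0 : H) :
    cancel f g -> cancel g f -> left_ideal_preserver f -> x0 <> 0 ->
  exists S S' D D' : H -> H,
    [/\ [/\ linear S, cancel S S' & cancel S' S],
        [/\ linear D, cancel D D' & cancel D' D],
        forall x, D x = S (g 1 x) & forall T x, f T (D x) = S (T x)].
Proof.
move=> fK gK fP x00.
have [S [S' [linS SK S'K fS]]] := preserver_intertwines fK gK fP x00.
pose D x := S (g 1 x).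
have fD T x : f T (D x) = S (T x).
  (* Taking T = [g 1] identifies y as D x. *)
  by have [y yE] := fS x; rewrite /D -yE gK yE.
have linD : linear D by move=> a x y; rewrite /D linearP linS.
have surjD y : exists x, D x = y.
  have [->|/eqP y0] := eqVneq y 0.
    exists 0; exact: linear_map0.
  have [x x_0 gx] :=
    preserver_vanishing gK fK (left_ideal_preserver_can gK fP) y0.
  have [[c ->]|/forallNP nxy] := pselect (exists c, y = c *: D x).
    exists (c *: x); exact: linear_mapZ.
  (* Otherwise [rank1 y k] kills D x, so its image under [g] kills x, and by the choice of x it also
     kills y, forcing y = 0. *)
  have [k [xk yk]] := separating nxy; case: y0.
  rewrite -[y]scale1r -yk -rank1E; apply/gx/(can_inj SK).
  rewrite -fD gK rank1E xk scale0r.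
  by rewrite (linear_map0 linS).
have [D' D'K] := choice surjD.
exists S, S', D, D'; split => //; split => // x.
apply: (can_inj SK); rewrite -[D' _]/((1 : boundedOp H) (D' (D x))).
by rewrite -fD D'K fD.
Qed.


(* The library's [Banach_Steinhauss] is restricted to real normed spaces.  The
   proof is a gliding hump: for all y and u, one of y + u and y - u has
   an inner product with v of modulus at least |<u, v>|, so a vector can be
   moved by steps of size 3^-n that keep its inner products with fast growing
   v (t n) large. *)
Lemma pointwise_bounded_family (T : Type) (v : T -> H) (w : T -> R[i]) :
    (forall t, 0 <= w t) ->
    (forall x, exists M, forall t, `|dot x (v t)| <= M * w t) ->
  exists2 M, 0 <= M & forall t, `|v t| <= M * w t.
Proof.
move=> w0 bnd; apply: contrapT => nbnd.
have coef_ge0 n : 0 <= n%:R * 2 * 3 ^+ n :> R[i].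
  by rewrite -natrX -!natrM ler0n.
(* The factor is n divided by 3^-n / 2, the share of |v (t n)| that survives all later steps. *)
have large n : exists t, n%:R * 2 * 3 ^+ n * w t < `|v t|.
  apply: contrapT => /forallNP le; apply: nbnd.
  exists (n%:R * 2 * 3 ^+ n) => // t.
  by rewrite real_leNgt ?ger0_real ?(mulr_ge0 (coef_ge0 _)) //; apply/negP/le.
have {large}[t tP] := choice large.
have v0 n : 0 < `|v (t n)| by apply: le_lt_trans (tP n); rewrite mulr_ge0.
pose r n : R[i] := 3^-1 ^+ n.
have r0 n : 0 < r n by rewrite exprn_gt0 // invr_gt0 ltr0n.
(* The later steps together move the vector by at most half of step n. *)
have r_half n : 3 / 2 * r n.+1 = r n / 2 by rewrite /r exprS; field.
pose u n := (r n / `|v (t n)|) *: v (t n).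
have uN n : `|u n| = r n.
  by rewrite normrZ ger0_norm ?divfK ?gt_eqF // ltW // divr_gt0.
have udot n : dot (u n) (v (t n)) = r n * `|v (t n)|.
  by rewrite dotZl -norm_dot expr2 mulrA divfK // gt_eqF.
pose good n y := r n * `|v (t n)| <= `|dot y (v (t n))|.
pose next n y := if good n (y + u n) then y + u n else y - u n.
have nextP n y : good n (next n y).
  rewrite /next; case: ifPn => //.
  have rv0 : 0 <= r n * `|v (t n)| by rewrite ltW // mulr_gt0.
  rewrite /good -real_ltNge ?ger0_real // real_leNgt ?ger0_real // => lt1.
  apply/negP => lt2; have := ltrD lt1 lt2.
  apply/negP; rewrite -real_leNgt ?ger0_real ?addr_ge0 //.
  apply: le_trans (ler_normB _ _).
  have -> : dot (y + u n) (v (t n)) - dot (y - u n) (v (t n)) =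
      r n * `|v (t n)| + r n * `|v (t n)| by rewrite dotDl dotBl udot; ring.
  by rewrite ger0_norm // addr_ge0.
pose x := fix x n := if n is m.+1 then next m (x m) else 0.
have [n|l lP] := @geometric_limit R H x.
  by rewrite /= /next; case: ifP => _; rewrite addrAC subrr add0r ?normrN uN.
(* M need not be real, but M w is nonnegative and so equals |M| w; hence n is taken to bound |M|. *)
have [M MP] := bnd l; have [n nP] := complex_nat_bound (normr_ge0 M).
have dot_l : `|dot l (v (t n))| <= n%:R * w (t n).
  apply: le_trans (MP _) _; have Mw0 := le_trans (normr_ge0 _) (MP (t n)).
  by rewrite -(ger0_norm Mw0) normrM (ger0_norm (w0 _)) ler_wpM2r.
have : r n * `|v (t n)| <= n%:R * w (t n) + r n / 2 * `|v (t n)|.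
  apply: le_trans (nextP n (x n)) _; rewrite -[next _ _]/(x n.+1).
  rewrite -[x n.+1](subKr l) dotBl; apply: le_trans (ler_normB _ _) _.
  rewrite lerD //; apply: le_trans (Cauchy_Schwarz _ _) _.
  by rewrite ler_wpM2r // -r_half.
have half_ge0 : 0 <= r n / 2 * `|v (t n)|.
  by rewrite ltW // mulr_gt0 // divr_gt0.
have nw_ge0 : 0 <= n%:R * w (t n) by rewrite mulr_ge0.
have rE : r n * `|v (t n)| = r n / 2 * `|v (t n)| + r n / 2 * `|v (t n)|.
  by field.
rewrite rE lerD2r; apply/negP; rewrite -real_ltNge ?ger0_real //.
rewrite /r exprVn -invfM [ltRHS]mulrC ltr_pdivlMr ?mulr_gt0 ?exprn_gt0 ?ltr0n //.
apply: le_lt_trans (tP n); rewrite le_eqVlt; apply/orP; left; apply/eqP.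
by ring.
Qed.

(** Uniform boundedness is applied to the family D y with weight |y|: for T = [rank1 x h], T' y = <D
    y, h> S x with S x nonzero, which bounds <D y, h> by a multiple of |y|. *)
Lemma intertwined_bounded (S D : H -> H) :
    (forall a x, S (a *: x) = a *: S x) ->
    (exists x, S x <> 0) ->
    (forall T : boundedOp H, exists T' : boundedOp H,
       forall y, T' y = S (T (D y))) ->
  exists2 M, 0 <= M & forall y, `|D y| <= M * `|y|.
Proof.
move=> SZ [x Sx] ST; apply: pointwise_bounded_family => // h.
have [T' T'E] := ST (rank1 x h); have [M M0 T'M] := bop_bounded T'.
exists (M / `|S x|) => y; have := T'M y; rewrite T'E rank1E SZ normrZ.
rewrite mulrAC ler_pdivlMr ?normr_gt0; last exact/eqP.
by rewrite dotC norm_conjC.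
Qed.

End Hilbert.

Theorem theorem4 (R : realType) (H : completeNormedModType R[i])
    (dot : {dot H for Num.conj})
    (norm_dot : forall x : H, `|x| ^+ 2 = dot x x)
    (phi : {linear boundedOp H -> boundedOp H})
    (phi_bij : bijective phi)
    (phi_ideals : forall L : set (boundedOp H),
       left_ideal L <-> left_ideal (phi @` L)) :
  exists A B : boundedOp H,
    [/\ invertible A, invertible B & forall T, phi T = A * T * B].
Proof.
(* If H = 0, all operators coincide and A = B = 1 works. *)
have [[x0 x00]|/forallNP H0] := pselect (exists x0 : H, x0 <> 0); last first.
  have all0 (S T : boundedOp H) : S = T.
    apply: boundedOp_eq => x.
    by rewrite (contrapT (H0 (S x))) (contrapT (H0 (T x))).
  by exists 1, 1; split => //; exists 1; split; apply: all0.
case: phi_bij => psi0 phiK psi0K.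
have psi_lin : linear psi0 := can2_linear phiK psi0K.
pose psi : {linear boundedOp H -> boundedOp H} :=
  HB.pack psi0 (GRing.isLinear.Build _ _ _ _ psi0 psi_lin).
have psiK : cancel psi phi := psi0K.
have [S [S' [D [D' [[linS SK S'K] [linD DK D'K] DE phiD]]]]] :=
  preserver_spatial norm_dot (phiK : cancel phi psi) psiK phi_ideals x00.
have SZ := linear_mapZ linS.
have S0 := linear_map0 linS.
have S'lin := can_linear linS SK S'K.
have D'lin := can_linear linD DK D'K.
have phiE T y : phi T y = S (T (D' y)) by rewrite -phiD D'K.
have D'bnd : exists2 M, 0 <= M & forall y, `|D' y| <= M * `|y|.
  apply: (intertwined_bounded norm_dot SZ).
    by exists x0; rewrite -S0 => /(can_inj SK).
  by move=> T; exists (phi T).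
have Dbnd : exists2 M, 0 <= M & forall y, `|D y| <= M * `|y|.
  apply: (intertwined_bounded norm_dot (linear_mapZ S'lin)).
    by exists x0; rewrite -(linear_map0 S'lin) => /(can_inj S'K).
  (* The inverse has the same form, psi T = S' T D. *)
  by move=> T; exists (psi T) => y; rewrite -{2}[T]psiK phiD SK.
have Db : D \in @bounded_linear _ H by apply/bounded_linearP.
have D'b : D' \in @bounded_linear _ H by apply/bounded_linearP.
pose B := BoundedOp D'b; pose B' := BoundedOp Db.
have AE x : (phi 1 * B') x = S x by rewrite bopME phiD.
exists (phi 1 * B'), B; split.
- exists (psi 1 * B); split; apply: boundedOp_eq => y; rewrite bopME AE.
    by rewrite -DE D'K.
  by apply: (can_inj SK); rewrite bopME -DE D'K.
- by exists B'; split; apply: boundedOp_eq => y; rewrite bopME /= ?DK ?D'K.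
- by move=> T; apply: boundedOp_eq => y; rewrite phiE bopME bopME AE.
Qed.
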